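(* Let $q=4$, $B=A$, $|A|=m-1$, and put $\theta=2^{4m+2|C|-3}$. (a) The coset graph $\Gamma_{\mathcal C_{\overline{\mathcal N}_2}^\perp}$ is a $3\theta$-regular graph with eigenvalues $3\theta,\ \theta,\ 0,\ -\theta$ having multiplicities $1,\ 6,\ 4^{2m+|C|}-16,\ 9$, respectively. (b) For every odd integer $\ell\ge3$, $\Gamma_{\mathcal C_{\overline{\mathcal N}_2}^\perp}$ is a strongly $\ell$-walk-regular graph with parameters $(\lambda_\ell,\mu_\ell,\nu_\ell)$, where $\lambda_\ell=\frac{(3^\ell-3)\theta^\ell}{4^{2m+|C|}}+\theta^{\ell-1}$ and $\mu_\ell=\nu_\ell=\frac{(3^\ell-3)\theta^\ell}{4^{2m+|C|}}$.
   Context: $\mathbb F_4$ is the field with four elements ($q=4$), $\mathbb F_4^*=\mathbb F_4\setminus\{0\}$, $m\ge2$, $[m]=\{1,\dots,m\}$, $\mathrm{supp}(v)=\{i:v_i\ne0\}$. For nonempty $P\subseteq[m]$, $\Delta_P=\{v\in\mathbb F_4^m:\mathrm{supp}(v)\subseteq P\}$, $\Delta_P^c=\mathbb F_4^m\setminus\Delta_P$. $A,B,C$ are nonempty subsets of $[m]$. Let $\mathcal N_2=\{(w_2+\omega,w_3,w_1)\in\mathbb F_4^{3m}: w_1\in\Delta_A^c,\ w_2\in\Delta_B,\ w_3\in\Delta_C,\ \omega\in\{\mathbf 0,w_1\}\}$, let $\overline{\mathcal N}_2$ contain exactly one element of each class $\{\alpha x:\alpha\in\mathbb F_4^*\}$,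 $x\in\mathcal N_2$, let $\mathcal C_{\overline{\mathcal N}_2}$ be the row span of the matrix whose columns are the elements of $\overline{\mathcal N}_2$, and $\mathcal C^\perp_{\overline{\mathcal N}_2}$ its Euclidean dual, of length $N$. For a linear code $\mathcal D\subseteq\mathbb F_q^N$, the weight of a coset is the minimum Hamming weight of its elements; the coset graph $\Gamma_{\mathcal D}$ has the cosets of $\mathcal D$ in $\mathbb F_q^N$ as vertices, two distinct cosets $x+\mathcal D$, $y+\mathcal D$ being adjacent iff the coset $x-y+\mathcal D$ has weight $1$. Eigenvalues of a graph are those of its adjacency matrix. For $\ell\ge2$, a graph is strongly $\ell$-walk-regular with parameters $(\lambda_\ell,\mu_\ell,\nu_\ell)$ if the number of walks of length $\ell$ between two vertices is $\lambda_\ell$ when they are adjacent, $\mu_\ell$ when they are distinct and non-adjacent, and $\nu_\ell$ when they are equal. *)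

(* Defs.v *)
From HB Require Import structures.
From mathcomp Require Import all_boot all_order all_algebra.
Set Implicit Arguments. Unset Strict Implicit. Unset Printing Implicit Defensive.
Import GRing.Theory.
Local Open Scope ring_scope.

Section Defs.
Variable F : finFieldType.

Definition supp m (v : 'rV[F]_m) : {set 'I_m} := [set i | v 0 i != 0].

Definition Delta m (P : {set 'I_m}) : {set 'rV[F]_m} := [set v | supp v \subset P].
Definition DeltaC m (P : {set 'I_m}) : {set 'rV[F]_m} := ~: Delta P.

Definition N2 m (A B C : {set 'I_m}) : {set 'rV[F]_(m + m + m)} :=
  [set x | [exists w1 : 'rV[F]_m, exists w2 : 'rV[F]_m, exists w3 : 'rV[F]_m,
            exists om : 'rV[F]_m,
     [&& w1 \in DeltaC A, w2 \in Delta B, w3 \in Delta C,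
         (om == 0) || (om == w1) &
         x == row_mx (row_mx (w2 + om) w3) w1]]].

Definition proj_reps k N (S : {set 'rV[F]_k}) (H : 'M[F]_(k, N)) : Prop :=
  (forall j, (col j H)^T \in S) /\
  (forall x, x \in S -> exists! j, exists2 a : F, a != 0 & x = a *: (col j H)^T).

Definition rowspan k N (H : 'M[F]_(k, N)) : {set 'rV[F]_N} := [set c | (c <= H)%MS].

Definition dual N (Cd : {set 'rV[F]_N}) : {set 'rV[F]_N} :=
  [set y | [forall c in Cd, c *m y^T == 0]].

Definition wt N (v : 'rV[F]_N) : nat := #|supp v|.

Definition coset N (D : {set 'rV[F]_N}) (x : 'rV[F]_N) : {set 'rV[F]_N} :=
  [set x + d | d in D].

Definition cosets N (D : {set 'rV[F]_N}) : {set {set 'rV[F]_N}} :=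
  [set coset D x | x : 'rV[F]_N].

Definition cwt N (S : {set 'rV[F]_N}) : nat := (\big[minn/N]_(z in S) wt z)%N.

Definition cvert N (D : {set 'rV[F]_N}) := {X : {set 'rV[F]_N} | X \in cosets D}.

Definition cadj N (D : {set 'rV[F]_N}) : rel (cvert D) :=
  fun X Y => (X != Y) &&
    [exists x in val X, exists y in val Y, cwt (coset D (x - y)) == 1%N].

End Defs.
Arguments cadj {F N} D.
Arguments coset {F N} D x.
Arguments cosets {F N} D.
Arguments cvert {F N} D.
Arguments dual {F N} Cd.
Arguments rowspan {F k N} H.
Arguments N2 {F m} A B C.
Arguments Delta {F m} P.
Arguments DeltaC {F m} P.

Section Graph.
Variables (V : finType) (e : rel V).

Definition adjmx : 'M[int]_#|V| := \matrix_(i, j) (e (enum_val i) (enum_val j))%:R.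

Definition regular (k : nat) : Prop := forall x, #|[set y | e x y]| = k.

Definition nwalks (l : nat) (x y : V) : nat :=
  #|[set f : {ffun 'I_l.+1 -> V} | [&& f ord0 == x, f ord_max == y &
      [forall i : 'I_l, e (f (widen_ord (leqnSn l) i)) (f (lift ord0 i))]]]|.

Definition strongly_walk_regular (l : nat) (lam mu nu : rat) : Prop :=
  forall x y, ((nwalks l x y)%:R : rat) =
    (if x == y then nu else if e x y then lam else mu).

End Graph.

(* Main.v *)
Require Import Defs.
From HB Require Import structures.
From mathcomp Require Import all_boot all_order all_algebra.
From mathcomp Require Import ring zify.
Import GRing.Theory.
Local Open Scope ring_scope.

(** Let [i0] be the coordinate outside [A]. Syndromes identify the cosets of [dual (rowspan H)]
    with the column space of [H], which consists of the vectors [(u, v, w)] with [supp v]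
    inside [C], and two cosets are adjacent iff their syndromes differ by an element of [N2].
    Membership in [N2] only sees [u_i0] and [w_i0]: it says that exactly one of [u_i0] and
    [u_i0 - w_i0] vanishes. So the graph is the 4 x 4 rook's graph with every cell blown up to
    [kap = theta / 2] vertices. Its characteristic polynomial follows from three uses of
    Sylvester's identity, passing from vertices to cells, then to the eight lines of the board,
    then to their two directions. Its walks follow from [M^2 = 2 kap J + 4 kap E], where [M] is
    the adjacency matrix, [J] the all-ones matrix and [E] the "same cell" matrix, since
    [M E = kap M] and [M J = 6 kap J]. *)

(** * Blow-ups of the rook's graph *)

(** Both sides come from the block matrix [M] with rows [(z, P)] and [(Q, 1)]: a unipotent factor on
    the right clears [Q], and a factor of determinant [z ^+ k] on the left clears it too. Keeping
    the powers of [z] on both sides avoids division, so [z] may be ['X]. *)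
Lemma det_sylvester (R : comNzRingType) (n k : nat) (z : R)
    (P : 'M[R]_(n, k)) (Q : 'M[R]_(k, n)) :
  \det (z%:M - P *m Q) * z ^+ k = z ^+ n * \det (z%:M - Q *m P).
Proof.
pose M := block_mx z%:M P Q 1%:M.
have detM : \det M = \det (z%:M - P *m Q).
  have /(congr1 determinant) :
      M *m block_mx 1%:M 0 (- Q) 1%:M = block_mx (z%:M - P *m Q) P 0 1%:M.
    by rewrite mulmx_block !mulmx1 !mulmx0 !mul1mx !add0r mulmxN subrr.
  by rewrite det_mulmx det_lblock det_ublock !det1 !mulr1.
rewrite -detM.
have -> : z ^+ k = \det (block_mx 1%:M 0 (- Q) (z%:M : 'M_k)).
  by rewrite det_lblock det1 mul1r det_scalar.
rewrite mulrC -det_mulmx.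
have -> : block_mx 1%:M 0 (- Q) z%:M *m M = block_mx z%:M P 0 (z%:M - Q *m P).
  rewrite mulmx_block !mul1mx !mul0mx !addr0 mulNmx mul_mx_scalar mul_scalar_mx addrC.
  by rewrite subrr mulNmx mulmx1 addrC.
by rewrite det_ublock det_scalar.
Qed.

(** Indexing by an arbitrary finite type lets the identity pass between vertices, cells, lines and
    directions without numbering them. *)
Definition fdet {R : comNzRingType} {S : finType} (f : S -> S -> R) : R :=
  \det (\matrix_(i < #|S|, j < #|S|) f (enum_val i) (enum_val j)).

Lemma eq_fdet (R : comNzRingType) (S : finType) (f g : S -> S -> R) :
  f =2 g -> fdet f = fdet g.
Proof. by move=> fg; congr (\det _); apply/matrixP=> i j; rewrite !mxE fg. Qed.

Lemma sum_enum_val (R : nmodType) (S : finType) (h : S -> R) :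
  \sum_(i < #|S|) h (enum_val i) = \sum_s h s.
Proof. by rewrite -big_enum_val. Qed.

Lemma fdet_sylvester (R : comNzRingType) (S T : finType) (z : R)
    (f : S -> T -> R) (g : T -> S -> R) :
  fdet (fun s s' => z * (s == s')%:R - \sum_t f s t * g t s') * z ^+ #|T|
  = z ^+ #|S| * fdet (fun t t' => z * (t == t')%:R - \sum_s g t s * f s t').
Proof.
pose P := \matrix_(i < #|S|, j < #|T|) f (enum_val i) (enum_val j).
pose Q := \matrix_(i < #|T|, j < #|S|) g (enum_val i) (enum_val j).
have -> : fdet (fun s s' => z * (s == s')%:R - \sum_t f s t * g t s')
    = \det (z%:M - P *m Q).
  congr (\det _); apply/matrixP=> i j; rewrite !mxE (inj_eq enum_val_inj) mulr_natr.
  rewrite -sum_enum_val; congr (_ - _).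
  by apply: eq_bigr => k _; rewrite !mxE.
have -> : fdet (fun t t' => z * (t == t')%:R - \sum_s g t s * f s t')
    = \det (z%:M - Q *m P).
  congr (\det _); apply/matrixP=> i j; rewrite !mxE (inj_eq enum_val_inj) mulr_natr.
  rewrite -sum_enum_val; congr (_ - _).
  by apply: eq_bigr => k _; rewrite !mxE.
exact: det_sylvester.
Qed.

Lemma fdet_bool (R : comNzRingType) (f : bool -> bool -> R) :
  fdet f = f true true * f false false - f true false * f false true.
Proof.
(* The size is generalised because [#|bool|] is not literally 2. The order of enumeration is
   irrelevant: exchanging both rows and columns preserves the determinant. *)
have det2 n (e : 'I_n -> bool) : n = 2 -> injective e ->
    \det (\matrix_(i, j) f (e i) (e j))
    = f true true * f false false - f true false * f false true.
  move=> n2; move: e; rewrite n2 => e e_inj.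
  rewrite (expand_det_row _ 0) !big_ord_recl big_ord0 /cofactor !det_mx11 !mxE /=.
  have : e 0 != e 1 by rewrite (inj_eq e_inj).
  have l0 : lift ord0 ord0 = 1 :> 'I_2 by apply: val_inj.
  have l1 : lift 1 ord0 = 0 :> 'I_2 by apply: val_inj.
  rewrite !l0 l1 /=.
  by case: (e 0); case: (e 1) => //= _; ring.
by apply: det2; [exact: card_bool | exact: enum_val_inj].
Qed.

Lemma sum_delta (R : pzSemiRingType) (S : finType) (a : S) (h : S -> R) :
  \sum_b (b == a)%:R * h b = h a.
Proof.
rewrite (bigD1 a) //= eqxx mul1r big1 ?addr0 // => b /negPf->.
exact: mul0r.
Qed.

Lemma sum_delta1 (R : pzSemiRingType) (S : finType) (a : S) :
  \sum_b (b == a)%:R = 1 :> R.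
Proof.
by rewrite -[RHS](sum_delta _ _ a (fun=> 1)); apply: eq_bigr => b _; rewrite mulr1.
Qed.

(** The exclusive or already excludes [s = t], where both coordinates agree. *)
Definition rook {T : eqType} (s t : T * T) := (s.1 == t.1) (+) (s.2 == t.2).

(** The last step is split off: [ext] appends [y] to a walk [g] of length [l], and the extended
    walks are then sorted by the end point [z] of [g]. *)
Lemma nwalksS (V : finType) (e : rel V) (l : nat) (x y : V) :
  nwalks e l.+1 x y = (\sum_z nwalks e l x z * e z y)%N.
Proof.
pose ext (g : {ffun 'I_l.+1 -> V}) :=
  [ffun k : 'I_l.+2 => if (k < l.+1)%N then g (inord k) else y].
have ext_widen g i : ext g (widen_ord (leqnSn l.+1) i) = g i.
  by rewrite ffunE /= ltn_ord; congr (g _); apply/val_inj; rewrite /= inordK.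
have ext_max g : ext g ord_max = y by rewrite ffunE ltnn.
have ext_inj : injective ext.
  by move=> g h gh; apply/ffunP => i; rewrite -!ext_widen gh.
pose W := [set g : {ffun 'I_l.+1 -> V} | [&& g ord0 == x, e (g ord_max) y &
  [forall i : 'I_l, e (g (widen_ord (leqnSn l) i)) (g (lift ord0 i))]]].
transitivity #|ext @: W|.
  apply: eq_card => f; rewrite inE; apply/idP/imsetP.
    case/and3P => /eqP f0 /eqP fmax /forallP fe.
    pose g := [ffun i : 'I_l.+1 => f (widen_ord (leqnSn l.+1) i)].
    exists g.
      rewrite inE !ffunE; apply/and3P; split.
      - by rewrite -f0; apply/eqP; congr (f _); apply/val_inj.
      - rewrite -fmax (_ : ord_max = lift ord0 ord_max :> 'I_l.+2); last exact/val_inj.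
        exact: fe.
      - apply/forallP => i; rewrite !ffunE.
        rewrite (_ : widen_ord _ (lift ord0 i) = lift ord0 (widen_ord (leqnSn l) i)).
          exact: fe.
        exact/val_inj.
    apply/ffunP => k; have [k_lt|k_ge] := ltnP k l.+1.
      have -> : k = widen_ord (leqnSn l.+1) (Ordinal k_lt) by apply/val_inj.
      by rewrite ext_widen ffunE.
    have -> : k = ord_max by apply/val_inj/eqP; rewrite /= eqn_leq -ltnS ltn_ord.
    by rewrite ext_max.
  case=> g; rewrite inE => /and3P[/eqP g0 gmax /forallP ge] ->.
  rewrite ext_max eqxx /=; apply/andP; split.
    have -> : ord0 = widen_ord (leqnSn l.+1) ord0 by apply/val_inj.
    by rewrite ext_widen g0.
  apply/forallP => i; rewrite ext_widen.
  have [i_lt|i_ge] := ltnP i l.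
    have -> : lift ord0 i = widen_ord (leqnSn l.+1) (lift ord0 (Ordinal i_lt)).
      exact/val_inj.
    by rewrite ext_widen; have := ge (Ordinal i_lt); rewrite (_ : widen_ord _ _ = i) //; apply/val_inj.
  have -> : i = ord_max by apply/val_inj/eqP; rewrite /= eqn_leq -ltnS ltn_ord.
  by rewrite (_ : lift ord0 ord_max = ord_max) ?ext_max //; exact/val_inj.
rewrite card_imset // -sum1_card (partition_big (fun g : {ffun 'I_l.+1 -> V} => g ord_max) xpredT) //=.
apply: eq_bigr => z _; rewrite sum1dep_card /nwalks.
have [ezy|nezy] := boolP (e z y).
  rewrite muln1; apply: eq_card => g; rewrite !inE -!andbA.
  by case: (g ord_max =P z) => [->|_]; rewrite ?ezy ?andbF ?andbT //= ?andbF.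
rewrite muln0; apply: eq_card0 => g; rewrite !inE.
by case: (g ord_max =P z) => [->|_]; rewrite ?(negPf nezy) ?andbF.
Qed.

Lemma nwalks0 (V : finType) (e : rel V) (x y : V) : nwalks e 0 x y = (x == y).
Proof.
rewrite /nwalks; have [->|xy] := eqVneq x y.
  transitivity #|[set [ffun=> y] : {ffun 'I_1 -> V}]|; last exact: cards1.
  apply: eq_card => f; rewrite !inE.
  apply/and3P/eqP => [[/eqP f0 _ _]|->]; last first.
    by split; rewrite ?ffunE //; apply/forallP => -[].
  by apply/ffunP => i; rewrite ffunE -f0; congr (f _); apply/val_inj; case: i => -[].
apply: eq_card0 => f; rewrite !inE; apply/and3P => -[/eqP f0 /eqP f1 _].
case/eqP: xy; rewrite -f0 -f1; congr (f _); exact/val_inj.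
Qed.

Section RookBlowup.
Variables (V T : finType) (e : rel V) (p q : V -> T) (kap : nat).
Hypothesis card_T : #|T| = 4%N.
Hypothesis kap_gt0 : (0 < kap)%N.
Hypothesis fibre : forall a b, #|[set v | (p v == a) && (q v == b)]| = kap.
Hypothesis e_rook : forall x y, e x y = (p x == p y) (+) (q x == q y).

Lemma sum_fibre (R : pzSemiRingType) (h : T -> T -> R) :
  \sum_v h (p v) (q v) = kap%:R * \sum_a \sum_b h a b.
Proof.
rewrite (partition_big p xpredT) //= mulr_sumr; apply: eq_bigr => a _.
rewrite (partition_big q xpredT) //= mulr_sumr; apply: eq_bigr => b _.
transitivity (\sum_(v in [set v | (p v == a) && (q v == b)]) h a b).
  by apply: eq_big => [v|v /andP[/eqP-> /eqP->]] //; rewrite inE.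
by rewrite sumr_const fibre mulr_natl.
Qed.

Lemma sum_same_cell (R : pzSemiRingType) (h : T -> T -> R) y :
  \sum_v h (p v) (q v) * ((p v == p y) && (q v == q y))%:R = kap%:R * h (p y) (q y).
Proof.
rewrite (sum_fibre _ (fun a b => h a b * ((a == p y) && (b == q y))%:R)); congr (_ * _).
rewrite (bigD1 (p y)) //= (bigD1 (q y)) //= !eqxx mulr1 !big1 ?addr0 //.
  by move=> a /negPf->; rewrite big1 // => b _; rewrite mulr0.
by move=> b /negPf->; rewrite andbF mulr0.
Qed.

Lemma sum_one (R : pzSemiRingType) : \sum_(a : T) 1 = 4%:R :> R.
Proof. by rewrite sumr_const card_T. Qed.

Lemma card_blowup : #|V| = (16 * kap)%N.
Proof.
have := sum_fibre nat (fun _ _ => 1).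
by rewrite !sumr_const card_T -mulrnA !natn => ->; rewrite mulnC.
Qed.

(* On the eight lines [T + T], the Gram matrix of [coord] is [4] plus the adjacency of
   lines in different directions, which factors through [side]. *)
Let coord (t : T * T) (s : T + T) : bool :=
  match s with inl a => t.1 == a | inr b => t.2 == b end.
Let side (s : T + T) : bool := if s is inl _ then true else false.

(** With [B] the incidence matrix of cells and lines, the rook adjacency is [B B^T - 2], which
    shifts [x] to [y]. The matrix [B^T B] is 4 plus a rank-two part, which shifts [y] to [z]. The
    hypotheses allow cancelling powers of [y] and [z]. *)
Lemma fdet_rook (R : idomainType) (x k : R) :
  x + 2%:R * k != 0 -> x - 2%:R * k != 0 ->
  fdet (fun s t : T * T => x * (s == t)%:R - k * (rook s t)%:R)
  = (x - 6%:R * k) * (x - 2%:R * k) ^+ 6 * (x + 2%:R * k) ^+ 9.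
Proof.
set y := x + _; set z := x - _ => y0 z0.
have card_TT : #|{: T * T}| = 16%N by rewrite card_prod card_T.
have card_sumT : #|{: T + T}| = 8%N by rewrite card_sum card_T.
pose Dlines := fdet (fun s s' : T + T =>
  y * (s == s')%:R - \sum_t k * (coord t s)%:R * (coord t s')%:R).
have cells : fdet (fun s t : T * T => x * (s == t)%:R - k * (rook s t)%:R) = y ^+ 8 * Dlines.
  apply: (mulIf (expf_neq0 8 y0)); rewrite mulrAC -exprD -[(8 + 8)%N]/16%N.
  transitivity (fdet (fun t u : T * T => y * (t == u)%:R -
      \sum_s (coord t s)%:R * (k * (coord u s)%:R)) * y ^+ #|{: T + T}|); last first.
    by rewrite fdet_sylvester card_TT.
  rewrite card_sumT; congr (_ * _); apply: eq_fdet => -[a b] [c d].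
  rewrite big_sumType /=.
  under eq_bigr do rewrite (eq_sym a).
  under [X in _ - (_ + X)]eq_bigr do rewrite (eq_sym b).
  rewrite /= !sum_delta /rook xpair_eqE /= /y.
  by rewrite (eq_sym a) (eq_sym b); do 2 case: eqP => _ /=; ring.
(* A line has four cells, parallel lines share none, and crossing lines share one. Hence the
   diagonal becomes [y - 4 k = z], and only pairs with different [side] remain off it. *)
have lines : Dlines = z ^+ 6 * (z ^+ 2 - (4%:R * k) ^+ 2).
  apply: (mulIf (expf_neq0 2 z0)).
  transitivity (fdet (fun s s' : T + T => z * (s == s')%:R -
      \sum_b (side s == b)%:R * (k * (side s' != b)%:R)) * z ^+ #|{: bool}|).
    rewrite card_bool; congr (_ * _); apply: eq_fdet => s s'.
    under [X in _ - X = _]eq_bigr do rewrite -mulrA.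
    rewrite -mulr_sumr.
    rewrite -(pair_bigA _ (fun a b => (coord (a, b) s)%:R * (coord (a, b) s')%:R)) /=.
    case: s s' => [c|c] [d|d] /=.
    - under eq_bigr do rewrite sumr_const card_T -mulrnAr.
      rewrite sum_delta big_bool /= -[inl c == _]/(c == d) /y /z; ring.
    - under eq_bigr do rewrite -mulr_sumr sum_delta1.
      rewrite sum_delta big_bool /=; ring.
    - under eq_bigr do rewrite sum_delta.
      rewrite sum_delta1 big_bool /=; ring.
    - under eq_bigr do rewrite sum_delta.
      rewrite sumr_const card_T big_bool /= -[inr c == _]/(c == d) /y /z; ring.
  rewrite fdet_sylvester card_sumT fdet_bool !big_sumType /=.
  rewrite !sumr_const card_T.
  rewrite /=; ring.
rewrite cells lines /z /y; ring.
Qed.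

(** The adjacency matrix factors through cells as (rook-adjacent to the cell of [x]) times (being
    the cell of [y]). In the reversed product each cell is summed over its [kap] vertices. *)
Lemma adjacency_det :
  fdet (fun x y : V => 'X * (x == y)%:R - (e x y)%:R) * 'X ^+ 16
  = 'X ^+ #|V| * fdet (fun s t : T * T => 'X * (s == t)%:R - kap%:R * (rook s t)%:R)
  :> {poly int}.
Proof.
have card_TT : #|{: T * T}| = 16%N by rewrite card_prod card_T.
rewrite -card_TT.
transitivity (fdet (fun x y : V => 'X * (x == y)%:R -
    \sum_(t : T * T) (rook (p x, q x) t)%:R * (t == (p y, q y))%:R) * 'X ^+ #|{: T * T}|
    : {poly int}).
  congr (_ * _); apply: eq_fdet => x y; congr (_ - _).
  rewrite (eq_bigr (fun t => (t == (p y, q y))%:R * (rook (p x, q x) t)%:R)).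
    by rewrite sum_delta /rook e_rook.
  by move=> t _; rewrite mulrC.
rewrite fdet_sylvester; congr (_ * _); apply: eq_fdet => s t; congr (_ - _).
rewrite (sum_fibre _ (fun a b => (s == (a, b))%:R * (rook (a, b) t)%:R)); congr (_ * _).
rewrite pair_big /= -[RHS](sum_delta _ _ s (fun s => (rook s t)%:R)).
by apply: eq_bigr => -[a b] _; rewrite eq_sym.
Qed.

Lemma char_poly_rook_blowup :
  char_poly (adjmx e) =
    ('X - (6 * kap)%N%:R%:P) * ('X - (2 * kap)%N%:R%:P) ^+ 6
    * 'X ^+ (16 * kap - 16) * ('X - (- (2 * kap)%N%:R)%:P) ^+ 9.
Proof.
have -> : char_poly (adjmx e) = fdet (fun x y : V => 'X * (x == y)%:R - (e x y)%:R).
  congr (\det _); apply/matrixP => i j.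
  by rewrite !mxE (inj_eq enum_val_inj) polyC_natr mulr_natr.
have X16 : 'X ^+ 16 != 0 :> {poly int} by rewrite expf_neq0 ?polyX_eq0.
apply: (mulIf X16).
rewrite adjacency_det fdet_rook.
(* Positivity of [kap] makes the truncated exponent [16 * kap - 16] an honest difference. *)
- rewrite polyCN !polyC_natr !natrM card_blowup -{1}(subnK (_ : 16 <= 16 * kap)%N); last lia.
  rewrite exprD; ring.
- by rewrite -natrM -polyC_natr -[_%:P]opprK -polyCN polyXsubC_eq0.
- by rewrite -natrM -polyC_natr polyXsubC_eq0.
Qed.

(** As a number, the exclusive or of two conditions is their sum minus twice their product, and the
    product singles out [s] itself. *)
Lemma rook_sum (R : pzRingType) (s : T * T) (h : T -> T -> R) :
  \sum_a \sum_b (rook s (a, b))%:R * h a b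
  = \sum_b h s.1 b + \sum_a h a s.2 - 2%:R * h s.1 s.2.
Proof.
transitivity (\sum_a \sum_b ((a == s.1)%:R * h a b + (b == s.2)%:R * h a b
    - 2%:R * ((b == s.2)%:R * ((a == s.1)%:R * h a b)))).
  apply: eq_bigr => a _; apply: eq_bigr => b _.
  rewrite /rook /= (eq_sym a) (eq_sym b).
  case: eqP => _; case: eqP => _ /=; rewrite ?mul0r ?mul1r ?mulr0 ?addr0 ?add0r ?subr0 ?oppr0 //.
  by rewrite mulr_natl mulr2n subrr.
under eq_bigr do rewrite sumrB big_split /= -mulr_sumr -mulr_sumr !sum_delta.
by rewrite sumrB big_split /= sum_delta -mulr_sumr sum_delta.
Qed.

Lemma degree_sum (R : comPzRingType) x : \sum_y (e x y)%:R = (6 * kap)%N%:R :> R.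
Proof.
under eq_bigr do rewrite e_rook -[_%:R]mulr1.
rewrite (sum_fibre _ (fun a b => ((p x == a) (+) (q x == b))%:R * 1)).
rewrite (rook_sum _ (p x, q x) (fun _ _ => 1)) !sum_one natrM; ring.
Qed.

Lemma regular_rook_blowup : regular e (6 * kap)%N.
Proof.
move=> x; have := degree_sum int x.
rewrite -natr_sum -big_mkcond sum1_card => /eqP.
rewrite Num.Theory.eqr_nat => /eqP <-; apply: eq_card => y.
by rewrite inE.
Qed.

Lemma sum_xor_delta (R : comPzRingType) (c : bool) (d : T) :
  \sum_b (c (+) (b == d))%:R = (if c then 3 else 1)%:R :> R.
Proof.
case: c => /=; last exact: sum_delta1.
transitivity (\sum_(b : T) (1 - (b == d)%:R) : R).
  by apply: eq_bigr => b _; case: eqP; rewrite ?subrr ?subr0.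
by rewrite sumrB sum_one sum_delta1; ring.
Qed.

(** Two distinct cells of the 4 x 4 board have two common neighbours whether or not they share a
    line, and a cell has six neighbours. So the square has no adjacency term, only the all-ones and
    same-cell terms. *)
Lemma two_walk_sum (R : comPzRingType) x y :
  \sum_z (e x z)%:R * (e z y)%:R
  = kap%:R * (2%:R + 4%:R * ((p x == p y) && (q x == q y))%:R) :> R.
Proof.
under eq_bigr do rewrite !e_rook.
rewrite (sum_fibre _ (fun a b => ((p x == a) (+) (q x == b))%:R
                               * ((a == p y) (+) (b == q y))%:R)).
rewrite (rook_sum _ (p x, q x) (fun a b => ((a == p y) (+) (b == q y))%:R)) /=.
rewrite sum_xor_delta; under [X in _ + X - _]eq_bigr do rewrite addbC.
rewrite sum_xor_delta; congr (_ * _).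
by do 2 case: (_ == _) => /=; ring.
Qed.

Lemma rook_blowup_strongly_walk_regular (l : nat) : odd l -> (3 <= l)%N ->
  strongly_walk_regular e l
    ((3 ^ l - 3)%N%:R * (2 * kap)%N%:R ^+ l / (16 * kap)%N%:R + (2 * kap)%N%:R ^+ (l - 1))
    ((3 ^ l - 3)%N%:R * (2 * kap)%N%:R ^+ l / (16 * kap)%N%:R)
    ((3 ^ l - 3)%N%:R * (2 * kap)%N%:R ^+ l / (16 * kap)%N%:R).
Proof.
move=> l_odd _ x y.
(* One formula covers the three cases, since [e x x] is false. *)
transitivity ((3 ^ l - 3)%N%:R * (2 * kap)%N%:R ^+ l / (16 * kap)%N%:R
    + (2 * kap)%N%:R ^+ (l - 1) * (e x y)%:R : rat); last first.
  case: eqP => [->|_]; first by rewrite e_rook !eqxx mulr0 addr0.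
  by case: (e x y); rewrite ?mulr1 ?mulr0 ?addr0.
have k0 : kap%:R != 0 :> rat by rewrite Num.Theory.pnatr_eq0 -lt0n.
(* Write [l = 2 h + 1] and induct on [h], adding two steps at a time. At [h = 0] the constant term
   vanishes because [3 ^ 1 - 3 = 0]. *)
rewrite -(odd_double_half l) l_odd add1n subn1 /=; elim: (l./2) y => [|h IHh] y.
  rewrite double0 subnn !mul0r add0r mul1r nwalksS natr_sum -[RHS](sum_delta _ _ x (fun z => (e z y)%:R)).
  by apply: eq_bigr => z _; rewrite nwalks0 natrM eq_sym.
transitivity (\sum_w ((nwalks e h.*2.+1 x w)%:R * (\sum_z (e w z)%:R * (e z y)%:R)) : rat).
  rewrite doubleS nwalksS natr_sum.
  under eq_bigr do rewrite natrM nwalksS natr_sum mulr_suml.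
  rewrite exchange_big /=; apply: eq_bigr => w _; rewrite mulr_sumr.
  by apply: eq_bigr => z _; rewrite natrM mulrA.
under eq_bigr do rewrite two_walk_sum IHh.
set c := _ / _.
transitivity (c * kap%:R * 2%:R * #|V|%:R + c * kap%:R * 4%:R * kap%:R
  + (2 * kap)%N%:R ^+ h.*2 * kap%:R * (2%:R * (6 * kap)%N%:R + 4%:R * kap%:R * (e x y)%:R) : rat).
  rewrite (eq_bigr (fun w => c * kap%:R * 2%:R
      + c * kap%:R * 4%:R * ((p w == p y) && (q w == q y))%:R
      + (2 * kap)%N%:R ^+ h.*2 * kap%:R * (2%:R * (e x w)%:R
      + 4%:R * (((p x == p w) (+) (q x == q w))%:R * ((p w == p y) && (q w == q y))%:R)))).
    rewrite !big_split /= sumr_const -!mulr_sumr big_split /= -!mulr_sumr degree_sum.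
    have -> : \sum_w ((p w == p y) && (q w == q y))%:R = kap%:R :> rat.
      rewrite -[RHS]mulr1 -(sum_same_cell _ (fun _ _ => 1) y).
      by apply: eq_bigr => w _; rewrite mul1r.
    have /= -> := sum_same_cell rat (fun a b => ((p x == a) (+) (q x == b))%:R) y.
    rewrite -e_rook.
    by rewrite [in RHS]mulr_natr mulrA.
  by move=> w _; rewrite -e_rook; ring.
(* The constant term obeys the recurrence [c' = 36 kap^2 c + 12 kap^2 (2 kap)^(2 h)], while the
   coefficient of [e x y] is multiplied by [4 kap^2]. *)
rewrite /c card_blowup !natrM doubleS !natrB ?natrX.
- rewrite !exprS; set u := 3%:R ^+ _; set v := (_ * _) ^+ _.
  by field; exact: k0.
- by rewrite !expnS; have := expn_gt0 3 h.*2; lia.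
- by rewrite !expnS; have := expn_gt0 3 h.*2; lia.
Qed.

End RookBlowup.

(** * Coset graphs through syndromes *)

Section Weight.
Variables (F : finFieldType) (N : nat).
Implicit Types (v : 'rV[F]_N) (S : {set 'rV[F]_N}).

Lemma wt_le v : (wt v <= N)%N.
Proof. by rewrite -[X in (_ <= X)%N]card_ord max_card. Qed.

Lemma wt_eq0 v : (wt v == 0)%N = (v == 0).
Proof.
rewrite cards_eq0; apply/eqP/eqP => [v0|->]; last first.
  by apply/setP => i; rewrite !inE mxE eqxx.
apply/rowP => i; rewrite mxE; apply/eqP.
by have /setP/(_ i) := v0; rewrite !inE => /negbFE.
Qed.

Lemma wt_delta (a : F) j : a != 0 -> wt (a *: 'e_j : 'rV_N) = 1%N.
Proof.
move=> a0; rewrite /wt; transitivity #|[set j]|; last exact: cards1.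
apply: eq_card => i.
rewrite !inE !mxE eqxx /=; case: (i == j) => /=.
  by rewrite mulr1 a0.
by rewrite mulr0 eqxx.
Qed.

Lemma wt_eq1 v : wt v = 1%N -> exists a j, a != 0 /\ v = a *: 'e_j.
Proof.
move/eqP/cards1P => -[j vj]; exists (v 0 j), j; split.
  by have /setP/(_ j) := vj; rewrite !inE eqxx.
apply/rowP => i; rewrite !mxE eqxx /=.
have /setP/(_ i) := vj; rewrite !inE; case: (i =P j) => [-> _|_ /negbFE/eqP]; first by rewrite mulr1.
by rewrite mulr0.
Qed.

Lemma cwt_le S v : v \in S -> (cwt S <= wt v)%N.
Proof.
move=> vS; rewrite /cwt; have := mem_index_enum v.
elim: (index_enum _) => //= z s IHs; rewrite inE big_cons => /predU1P[<-|/IHs sv].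
  by rewrite vS geq_minl.
by case: ifP => // _; apply: leq_trans (geq_minr _ _) sv.
Qed.

Lemma cwt_attained S v n :
  v \in S -> (cwt S <= n)%N -> exists2 z, z \in S & (wt z <= n)%N.
Proof.
move=> vS; case: (boolP [exists z in S, wt z <= n]%N) => [/exists_inP//|].
rewrite negb_exists_in => /forall_inP wt_gt; rewrite leqNgt => /negP[].
have {}wt_gt z : z \in S -> (n < wt z)%N by rewrite ltnNge; apply: wt_gt.
(* The default value [N] of the minimum also exceeds [n], because the member [v] has weight above
   [n] and at most [N]. *)
rewrite /cwt; apply: (big_ind (fun k => n < k)%N) => //; first exact: leq_trans (wt_gt v vS) (wt_le v).
by move=> a b na nb; rewrite leq_min na.
Qed.

End Weight.

Section Syndrome.
Variables (F : finFieldType) (k N : nat) (H : 'M[F]_(k, N)).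
Let D := dual (rowspan H).
Implicit Types X Y : cvert D.

Lemma mem_dual_rowspan y : (y \in D) = (y *m H^T == 0).
Proof.
have -> : (y *m H^T == 0) = (H *m y^T == 0).
  by rewrite -(inj_eq trmx_inj) trmx_mul trmxK trmx0.
rewrite inE; apply/forall_inP/eqP => [yD|Hy c].
  apply/row_matrixP => i; rewrite row_mul row0; apply/eqP/yD.
  by rewrite inE row_sub.
by rewrite inE => /submxP[u ->]; rewrite -mulmxA Hy mulmx0.
Qed.

Lemma mem_coset_dual x y : (y \in coset D x) = (y *m H^T == x *m H^T).
Proof.
rewrite -subr_eq0 -mulmxBl -mem_dual_rowspan.
apply/imsetP/idP => [[d dD ->]|yxD]; first by rewrite addrC addKr.
by exists (y - x); rewrite // addrC subrK.
Qed.

Lemma cvertP (X : cvert D) : exists x, val X = coset D x.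
Proof. by have /imsetP[x _ ->] := valP X; exists x. Qed.

(** Any representative gives the same value because [H] is a parity-check matrix of [D]. The default
    0 is never reached, as cosets are nonempty. *)
Definition syndrome (X : cvert D) : 'rV[F]_k := odflt 0 [pick x in val X] *m H^T.

Lemma syndromeE X x : x \in val X -> syndrome X = x *m H^T.
Proof.
rewrite /syndrome; have [z ->] := cvertP X => xz.
case: pickP => [y yz|/(_ x)]; last by rewrite xz.
by move: xz yz; rewrite !mem_coset_dual => /eqP-> /eqP->.
Qed.

Lemma mem_syndrome X x : (x \in val X) = (x *m H^T == syndrome X).
Proof.
have [z zX] := cvertP X.
have zz : z \in val X by rewrite zX mem_coset_dual.
by rewrite (syndromeE _ _ zz) zX mem_coset_dual.
Qed.

Lemma cvert_nonempty X : exists x, x \in val X.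
Proof. by have [z ->] := cvertP X; exists z; rewrite mem_coset_dual. Qed.

Lemma syndrome_inj : injective syndrome.
Proof.
by move=> X Y XY; apply/val_inj/setP => x; rewrite !mem_syndrome XY.
Qed.

Lemma syndrome_sub X : (syndrome X <= H^T)%MS.
Proof. exact: submxMl. Qed.

Lemma syndrome_surj r : (r <= H^T)%MS -> exists X, syndrome X = r.
Proof.
case/submxP => x ->; have xD : coset D x \in cosets D by apply: imset_f.
exists (Sub (coset D x) xD : cvert D); apply: syndromeE.
by rewrite SubK mem_coset_dual.
Qed.

(** A coset of weight 1 contains a nonzero multiple of a unit vector, so its syndrome is a nonzero
    multiple of a column of [H]. These multiples are exactly the elements of [S], by closure under
    scaling and the choice of representatives. *)
Lemma cadj_syndrome (S : {set 'rV[F]_k}) X Y :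
  proj_reps S H -> 0 \notin S ->
  (forall (a : F) x, a != 0 -> x \in S -> a *: x \in S) ->
  cadj D X Y = (syndrome X - syndrome Y \in S).
Proof.
move=> [colS Scol] S0 Sscale.
have delta_syn (a : F) j : (a *: 'e_j) *m H^T = a *: (col j H)^T.
  by rewrite -scalemxAl -rowE tr_col.
have cwt1 z : (cwt (coset D z) == 1%N) = (z *m H^T \in S).
  have zz : z \in coset D z by rewrite mem_coset_dual.
  apply/eqP/idP => [cz1|zS].
    have [v vz v1] : exists2 v, v \in coset D z & (wt v <= 1)%N.
      by apply: cwt_attained zz _; rewrite cz1.
    have /wt_eq1[a [j [a0 va]]] : wt v = 1%N.
      by apply/eqP; rewrite eqn_leq v1 -cz1 cwt_le.
    move: vz; rewrite mem_coset_dual => /eqP<-; rewrite va delta_syn.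
    exact: Sscale.
  apply/eqP; rewrite eqn_leq; apply/andP; split.
    have [j [[a a0 zj] _]] := Scol _ zS.
    rewrite -(wt_delta _ _ _ j a0) cwt_le // mem_coset_dual delta_syn zj //.
  (* Weight 0 would put the zero vector in the coset, hence 0 in [S]. *)
  rewrite ltnNge; apply/negP => /(cwt_attained _ _ _ _ _ zz)[v].
  rewrite leqn0 wt_eq0 mem_coset_dual => vz /eqP v0.
  by move: vz S0; rewrite v0 mul0mx => /eqP->; rewrite zS.
apply/andP/idP => [[_ /exists_inP[x xX /exists_inP[y yY]]]|XYS].
  by rewrite cwt1 mulmxBl -(syndromeE _ _ xX) -(syndromeE _ _ yY).
split; first by apply: contraNneq S0 => XY; rewrite -(subrr (syndrome Y)) -{1}XY.
have [[x xX] [y yY]] := (cvert_nonempty X, cvert_nonempty Y).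
apply/exists_inP; exists x => //; apply/exists_inP; exists y => //.
by rewrite cwt1 mulmxBl -(syndromeE _ _ xX) -(syndromeE _ _ yY).
Qed.

End Syndrome.

(** * The column set [N2] and its span *)

Lemma card_row_family (F : finFieldType) (n : nat) (P : 'I_n -> pred F) :
  #|[set r : 'rV[F]_n | [forall i, P i (r 0 i)]]| = (\prod_i #|P i|)%N.
Proof.
pose row_of (f : {ffun 'I_n -> F}) : 'rV[F]_n := \row_i f i.
have row_of_inj : injective row_of.
  by move=> f g /rowP fg; apply/ffunP => i; have := fg i; rewrite !mxE.
transitivity #|family P|; last by rewrite card_family foldrE big_map big_enum.
rewrite -(card_imset _ row_of_inj); apply: eq_card => r; rewrite inE.
apply/forallP/imsetP => [Pr|[f /familyP fP ->] i]; last by rewrite mxE; apply: fP.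
exists [ffun i => r 0 i]; last by apply/rowP => i; rewrite mxE ffunE.
by apply/familyP => i; rewrite ffunE; apply: Pr.
Qed.

Lemma mem_Delta (F : finFieldType) (m : nat) (P : {set 'I_m}) (v : 'rV[F]_m) :
  (v \in Delta P) = [forall i, (i \notin P) ==> (v 0 i == 0)].
Proof.
rewrite inE; apply/subsetP/forall_inP => vP i.
  by apply: contraR => v0; apply: vP; rewrite inE.
by rewrite inE; apply: contraR => /vP.
Qed.

Lemma exists_nonzero_neq (F : finFieldType) (a : F) :
  (2 < #|F|)%N -> exists2 c : F, c != 0 & c != a.
Proof.
move=> F2; have [/existsP[c /andP[]]|] := boolP [exists c : F, (c != 0) && (c != a)].
  by exists c.
rewrite negb_exists => /forallP F0a; move: F2; rewrite ltnNge => /negP[].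
have <- : #|[set 0; a]| = #|F|.
  by apply: eq_card => c; rewrite !inE; have := F0a c; rewrite negb_and !negbK.
by rewrite cards2; case: (_ != _).
Qed.

Section N2.
Variables (F : finFieldType) (m : nat) (C : {set 'I_m}) (i0 : 'I_m).

Let iu (i : 'I_m) : 'I_(m + m + m) := lshift m (lshift m i).
Let iv (i : 'I_m) : 'I_(m + m + m) := lshift m (rshift m i).
Let iw (i : 'I_m) : 'I_(m + m + m) := rshift (m + m) i.
Let A := [set~ i0].

Lemma mem_DeltaC1 (v : 'rV[F]_m) : (v \in Delta A) = (v 0 i0 == 0).
Proof.
rewrite mem_Delta; apply/forall_inP/eqP => [v0|v0 i]; first by apply/eqP/v0; rewrite !inE eqxx.
by rewrite !inE negbK => /eqP->; rewrite v0.
Qed.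

(** Since [w2] is constrained only by vanishing at [i0], the first block is free elsewhere, and at
    [i0] it equals [om], which is 0 or [w1] there. *)
Lemma mem_N2 (x : 'rV[F]_(m + m + m)) :
  (x \in N2 A A C) = [&& x 0 (iw i0) != 0,
    (x 0 (iu i0) == 0) || (x 0 (iu i0) == x 0 (iw i0)) &
    [forall i, (i \notin C) ==> (x 0 (iv i) == 0)]].
Proof.
rewrite inE; apply/idP/idP.
  case/existsP => w1 /existsP[w2 /existsP[w3 /existsP[om]]].
  rewrite in_setC !mem_DeltaC1 mem_Delta => /and5P[w10 /eqP w20 /forall_inP w3C omE /eqP->].
  rewrite row_mxEr w10 !row_mxEl !mxE w20 add0r /=; apply/andP; split.
    by case/orP: omE => /eqP->; rewrite ?mxE eqxx ?orbT.
  by apply/forall_inP => i /w3C; rewrite row_mxEl row_mxEr.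
case/and3P => xw xu xv.
(* This choice makes the first block minus [om] vanish at [i0]. *)
pose om : 'rV[F]_m := if x 0 (iu i0) == 0 then 0 else rsubmx x.
apply/existsP; exists (rsubmx x); apply/existsP; exists (lsubmx (lsubmx x) - om).
apply/existsP; exists (rsubmx (lsubmx x)); apply/existsP; exists om.
rewrite in_setC !mem_DeltaC1 mem_Delta subrK !hsubmxK eqxx andbT !mxE.
apply/and4P; split => //.
- by rewrite /om; case: eqP xu => [-> _|_ /eqP xu]; rewrite !mxE -?[X in X - _]xu ?subrr // xu subrr.
- apply/forall_inP => i iC; rewrite !mxE.
  exact: (implyP (forallP xv i) iC).
- by rewrite /om; case: ifP; rewrite eqxx ?orbT.
Qed.

Lemma N2_neq0 : 0 \notin N2 (F := F) A A C.
Proof. by rewrite mem_N2 mxE eqxx. Qed.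

Lemma N2_scale (a : F) x : a != 0 -> x \in N2 A A C -> a *: x \in N2 A A C.
Proof.
move=> a0; rewrite !mem_N2 !mxE mulf_eq0 (negPf a0) /= mulf_eq0 (negPf a0) /=.
rewrite (inj_eq (mulfI a0)) => /and3P[-> -> /forall_inP xv] /=.
by apply/forall_inP => i /xv /eqP xi; rewrite mxE xi mulr0.
Qed.

(** For the converse, [r] is written as a sum of four elements of [N2]: [c (eu + ew)], [d ew],
    [(b - a - d) ew], and a remainder whose [u] and [w] coordinates at [i0] both equal [a - c]. The
    choices of [c] and [d] keep all these scalars nonzero. *)
Lemma span_N2 (N : nat) (H : 'M[F]_(m + m + m, N)) (r : 'rV[F]_(m + m + m)) :
  (2 < #|F|)%N -> proj_reps (N2 A A C) H ->
  (r <= H^T)%MS = [forall i, (i \notin C) ==> (r 0 (iv i) == 0)].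
Proof.
move=> F2 [colN Ncol].
have N_sub x : x \in N2 A A C -> (x <= H^T)%MS.
  by case/Ncol => j [[a _ ->] _]; rewrite tr_col scalemx_sub ?row_sub.
apply/idP/forall_inP => [/submxP[y ->] i iC|rv].
  rewrite mxE big1 // => j _; have := colN j; rewrite mem_N2 => /and3P[_ _ /forall_inP/(_ i iC)].
  by rewrite !mxE => /eqP->; rewrite mulr0.
set a := r 0 (iu i0); set b := r 0 (iw i0).
have [c c0 ca] := exists_nonzero_neq F a F2.
have [d d0 dba] := exists_nonzero_neq F (b - a) F2.
pose eu : 'rV[F]_(m + m + m) := 'e_(iu i0); pose ew : 'rV[F]_(m + m + m) := 'e_(iw i0).
have N_ew t : t != 0 -> t *: ew \in N2 A A C.
  move=> t0; rewrite mem_N2 !mxE eqxx /= /iu /iv /iw !eq_shift !eqxx /= mulr0 mulr1 t0 eqxx /=.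
  by apply/forall_inP => i _; rewrite !mxE !eq_shift mulr0.
have N_c : c *: (eu + ew) \in N2 A A C.
  rewrite mem_N2 !mxE eqxx /= /iu /iv /iw !eq_shift !eqxx /= ?add0r ?addr0 mulr1 c0 eqxx orbT /=.
  by apply/forall_inP => i _; rewrite !mxE !eq_shift addr0 mulr0.
have -> : r = (r - c *: (eu + ew) - d *: ew - (b - a - d) *: ew)
              + (b - a - d) *: ew + d *: ew + c *: (eu + ew) by rewrite !subrK.
apply: addmx_sub (N_sub _ N_c); apply: addmx_sub (N_sub _ (N_ew _ d0)).
have bad : b - a - d != 0 by rewrite subr_eq0 eq_sym.
apply: addmx_sub (N_sub _ (N_ew _ bad)); apply: N_sub.
rewrite mem_N2 !mxE eqxx /= /iu /iv /iw !eq_shift !eqxx /=.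
rewrite -/(iu i0) -/(iw i0) -/a -/b.
have -> : b - c * (0 + 1) - d * 1 - (b - a - d) * 1 = a - c by ring.
have -> : a - c * (1 + 0) - d * 0 - (b - a - d) * 0 = a - c by ring.
rewrite eqxx orbT subr_eq0 eq_sym ca /=.
apply/forall_inP => i iC; rewrite !mxE !eq_shift /=.
by rewrite (eqP (rv i iC)) !(mulr0, addr0, subr0).
Qed.

Lemma card_fibre_span (a b : F) :
  #|[set r : 'rV[F]_(m + m + m) |
     [&& [forall i, (i \notin C) ==> (r 0 (iv i) == 0)], r 0 (iu i0) == a & r 0 (iw i0) == b]]|
  = (#|F| ^ (m - 1) * #|F| ^ #|C| * #|F| ^ (m - 1))%N.
Proof.
pose P (i : 'I_(m + m + m)) : pred F := match split i with
  | inl k => match split k with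
    | inl j => if j == i0 then pred1 a else predT
    | inr j => if j \in C then predT else pred1 0
    end
  | inr j => if j == i0 then pred1 b else predT
  end.
have Pu j : P (iu j) = if j == i0 then pred1 a else predT.
  by rewrite /P (unsplitK (inl (lshift m j))) (unsplitK (inl j)).
have Pv j : P (iv j) = if j \in C then predT else pred1 0.
  by rewrite /P (unsplitK (inl (rshift m j))) (unsplitK (inr j)).
have Pw j : P (iw j) = if j == i0 then pred1 b else predT.
  by rewrite /P (unsplitK (inr j)).
transitivity #|[set r : 'rV[F]_(m + m + m) | [forall i, P i (r 0 i)]]|.
  apply: eq_card => r; rewrite !inE; apply/and3P/forallP.
    case=> /forall_inP rv /eqP ru /eqP rw i.
    rewrite -(splitK i); case: (split i) => [k|j] /=; last first.
      by rewrite -/(iw j) Pw; case: eqP => // ->; rewrite /= rw.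
    rewrite -(splitK k); case: (split k) => j /=.
      by rewrite -/(iu j) Pu; case: eqP => // ->; rewrite /= ru.
    by rewrite -/(iv j) Pv; case: ifPn => //= /rv.
  move=> rP; split.
  - by apply/forall_inP => i iC; have := rP (iv i); rewrite Pv (negPf iC).
  - by have := rP (iu i0); rewrite Pu eqxx.
  - by have := rP (iw i0); rewrite Pw eqxx.
rewrite card_row_family big_split_ord big_split_ord /=.
have prod_point (c : F) : (\prod_(j < m) #|if j == i0 then pred1 c else predT| = #|F| ^ (m - 1))%N.
  rewrite (bigD1 i0) //= eqxx card1 mul1n.
  rewrite (eq_bigr (fun=> #|F|)) => [|j /negPf->]; last exact: eq_card.
  by rewrite prod_nat_const cardC1 card_ord subn1.
congr (_ * _ * _)%N.
- by under eq_bigr do rewrite -/(iu _) Pu; exact: prod_point.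
- under eq_bigr do rewrite -/(iv _) Pv.
  rewrite (eq_bigr (fun j => if j \in C then #|F| else 1%N)) => [|j _].
    by rewrite -big_mkcond prod_nat_const.
  by case: ifP => _; [exact: eq_card | exact: card1].
- by under eq_bigr do rewrite -/(iw _) Pw; exact: prod_point.
Qed.

End N2.

(** * The coset graph as a blown-up rook's graph *)

Theorem mainTheorem20 (F : finFieldType) (m : nat) (A C : {set 'I_m}) (N : nat)
  (H : 'M[F]_(m + m + m, N)) :
  #|F| = 4%N -> (2 <= m)%N -> A != set0 -> C != set0 -> #|A| = (m - 1)%N ->
  proj_reps (N2 A A C) H ->
  let D := dual (rowspan H) in
  let theta : nat := (2 ^ (4 * m + 2 * #|C| - 3))%N in
  [/\ regular (cadj D) (3 * theta)%N,
      char_poly (adjmx (cadj D)) =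
        ('X - ((3 * theta)%N%:R)%:P) * ('X - (theta%:R)%:P) ^+ 6
        * 'X ^+ (4 ^ (2 * m + #|C|) - 16)%N * ('X - (- (theta%:R))%:P) ^+ 9 &
      forall l : nat, odd l -> (3 <= l)%N ->
        strongly_walk_regular (cadj D) l
          ((3 ^ l - 3)%N%:R * theta%:R ^+ l / (4 ^ (2 * m + #|C|))%N%:R
             + theta%:R ^+ (l - 1))
          ((3 ^ l - 3)%N%:R * theta%:R ^+ l / (4 ^ (2 * m + #|C|))%N%:R)
          ((3 ^ l - 3)%N%:R * theta%:R ^+ l / (4 ^ (2 * m + #|C|))%N%:R)].
Proof.
move=> F4 m2 _ _ cardA reps D theta.
have F2 : (2 < #|F|)%N by rewrite F4.
have [i0 AE] : exists i0, A = [set~ i0].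
  have /eqP/cards1P[i0 CA] : #|~: A| = 1%N.
    by have := cardsC A; rewrite cardA card_ord; lia.
  by exists i0; rewrite -CA setCK.
rewrite {}AE {cardA} in reps.
(* The factors count the free coordinates of a syndrome in the blocks [u], [v] and [w] once those of
   [u] and [w] at [i0] are fixed. *)
pose kap := (4 ^ (m - 1) * 4 ^ #|C| * 4 ^ (m - 1))%N.
have kap_gt0 : (0 < kap)%N by rewrite !muln_gt0 !expn_gt0.
have thetaE : theta = (2 * kap)%N.
  rewrite /theta /kap -!expnD -[4%N]/(2 ^ 2)%N -expnM -expnS; congr (2 ^ _)%N; lia.
have orderE : (4 ^ (2 * m + #|C|) = 16 * kap)%N.
  rewrite /kap -!expnD -[16%N]/(4 ^ 2)%N -expnD; congr (4 ^ _)%N; lia.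
pose u (X : cvert D) := syndrome _ _ _ H X 0 (lshift m (lshift m i0)).
pose w (X : cvert D) := syndrome _ _ _ H X 0 (rshift (m + m) i0).
have syn_v X : [forall i, (i \notin C) ==> (syndrome _ _ _ H X 0 (lshift m (rshift m i)) == 0)].
  by rewrite -(span_N2 _ _ _ i0 _ _ _ F2 reps) syndrome_sub.
(* The board coordinates are [u] and [u - w], with values in [F]. For differences [U] and [W], the
   condition that [W] is nonzero and [U] is 0 or [W] says that exactly one of [U = 0] and [U = W]
   holds. *)
have subE (r s : 'rV[F]_(m + m + m)) i : (r - s) 0 i = r 0 i - s 0 i by rewrite !mxE.
have adj X Y : cadj D X Y = (u X == u Y) (+) (u X - w X == u Y - w Y).
  rewrite (cadj_syndrome _ _ _ _ _ X Y reps (N2_neq0 _ _ _ _)); last by move=> *; apply: N2_scale.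
  rewrite mem_N2 !subE -/(u X) -/(u Y) -/(w X) -/(w Y).
  have -> /= : [forall i, (i \notin C) ==> ((syndrome _ _ _ H X - syndrome _ _ _ H Y)
      0 (lshift m (rshift m i)) == 0)].
    apply/forall_inP => i iC; rewrite subE.
    have /eqP-> := forall_inP (syn_v X) i iC.
    by have /eqP-> := forall_inP (syn_v Y) i iC; rewrite subr0.
  have -> : (u X - w X == u Y - w Y) = (u X - u Y == w X - w Y).
    by rewrite -subr_eq0 -[RHS]subr_eq0; congr (_ == 0); ring.
  rewrite -(subr_eq0 (u X)) andbT; move: (u X - u Y) (w X - w Y) => U W.
  have [->|U0] := eqVneq U 0; first by rewrite andbT eq_sym addTb.
  by have [<-|_] := eqVneq U W; rewrite ?U0 ?andbF.
have fibre a b : #|[set X : cvert D | (u X == a) && (u X - w X == b)]| = kap.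
  (* Syndromes biject vertices with the column space of [H], and [u = a], [u - w = b] amount to
     [u = a], [w = a - b]. *)
  rewrite -(card_imset _ (@syndrome_inj _ _ _ H)) /kap -F4 -(card_fibre_span _ _ C i0 a (a - b)).
  apply: eq_card => r; rewrite inE; apply/imsetP/and3P.
    case=> X; rewrite inE => /andP[/eqP uX /eqP wX] ->.
    rewrite syn_v -/(u X) -/(w X) uX -wX uX; split => //.
    by apply/eqP; ring.
  case; rewrite -(span_N2 _ _ _ i0 _ _ _ F2 reps) => /syndrome_surj[X Xr] /eqP ua /eqP wb.
  exists X => //; rewrite inE /u /w Xr ua wb eqxx /=.
  by apply/eqP; ring.
rewrite orderE thetaE (_ : 3 * (2 * kap) = 6 * kap)%N; last lia.
split.
- exact: regular_rook_blowup F4 fibre adj.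
- exact: char_poly_rook_blowup F4 kap_gt0 fibre adj.
- by move=> l l_odd l3; apply: (rook_blowup_strongly_walk_regular _ _ _ _ _ _ F4 kap_gt0 fibre adj).
Qed.
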